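(* Let $\alpha:I\to\mathbb{E}^4_1$ be a null Cartan curve and suppose $V=\lambda_0T+\mu_0N+\nu_0B_1$ with $\lambda_0=0$, $\nu_0\neq0$ and $\mu_0^2+\nu_0^2=1$ ($\mu_0,\nu_0$ real constants), so $V=\mu_0N+\nu_0B_1$. Then: (a) the constraint $\lambda_0=\nu_0\kappa_2$ forces $\kappa_2=0$; (b) with $\kappa_2=0$, the equation $\kappa_3r^2+\kappa_2^2r-\kappa_3=0$, $r=\mu_0/\nu_0$, reduces to $\kappa_3(r^2-1)=0$, so for $\kappa_3\neq0$ one has $r=\pm1$, i.e. $\mu_0=\pm\nu_0=\pm1/\sqrt2$; the two unit axes are (up to sign) $V_+=(N+B_1)/\sqrt2$ and $V_-=(N-B_1)/\sqrt2$, with $\langle V_+,V_-\rangle=0$; (c) for $W=aT+bN+cB_1+dB_2$, the condition $\langle V,W\rangle=c_0$ simplifies to $\mu_0b+\nu_0c=c_0$ (the null coupling $\lambda_0d$ vanishes); (d) (with $\kappa_2=0$ and $\kappa_3$ a nonzero constant) the tangent field satisfies $T^{(4)}-\kappa_3^2T=0$, with eigenvalues $\pm|\kappa_3|^{1/2}$ and $\pm i|\kappa_3|^{1/2}$.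
   Context: Minkowski space-time $\mathbb{E}^4_1$ is $\mathbb{R}^4$ with the metric $\langle x,y\rangle=-x_1y_1+x_2y_2+x_3y_3+x_4y_4$. A null Cartan curve is a smooth null curve $\alpha:I\to\mathbb{E}^4_1$ ($I$ an interval, $\alpha'\neq0$, $\langle\alpha',\alpha'\rangle=0$) parametrized by pseudo-arc length $s$ (so $\langle\alpha'',\alpha''\rangle=1$), together with its Cartan frame $\{T,N,B_1,B_2\}$, $T=\alpha'$, $N=\alpha''$, where $\langle T,T\rangle=\langle B_2,B_2\rangle=0$, $\langle N,N\rangle=\langle B_1,B_1\rangle=1$, $\langle T,B_2\rangle=1$, all other inner products of frame vectors vanish, $\det(T,N,B_1,B_2)=1$, and $$T'=N,\quad N'=\kappa_2B_1-B_2,\quad B_1'=\kappa_3T-\kappa_2N,\quad B_2'=-\kappa_3B_1$$ for smooth functions $\kappa_2,\kappa_3:I\to\mathbb{R}$ (the Cartan curvatures). Primes and $T^{(4)}$ denote derivatives in $s$. ''Unit axes'' here means the unit fields $V$ of the stated form satisfying the two constraints $\lambda_0=\nu_0\kappa_2$ and $\kappa_3r^2+\kappa_2^2r-\kappa_3=0$. ''Eigenvalues'' of a linear constant-coefficient ODE are the roots of its characteristic polynomial. *)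

(* Defs.v *)
From HB Require Import structures.
From mathcomp Require Import all_boot all_order all_algebra.
From mathcomp Require Import all_classical all_reals all_analysis.
From mathcomp Require Import complex.

Set Implicit Arguments.
Unset Strict Implicit.
Unset Printing Implicit Defensive.

Import Order.TTheory GRing.Theory Num.Theory.
Import numFieldNormedType.Exports.

Local Open Scope classical_set_scope.
Local Open Scope ring_scope.

(* The coordinates x_1, ..., x_4 are indexed by 0, ..., 3. *)
Definition mink_dot (R : realType) (x y : 'rV[R]_4) : R :=
  - (x 0 0 * y 0 0) + x 0 1 * y 0 1 + x 0 2 * y 0 2 + x 0 3 * y 0 3.

Definition frame_mx (R : realType) (x y z w : 'rV[R]_4) : 'M[R]_4 :=
  \matrix_(i < 4) nth 0 [:: x; y; z; w] i.

(* A nondegenerate interval, of any kind (open or not, bounded or not). *)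
Definition curve_domain (R : realType) (I : set R) : Prop :=
  is_interval I /\ exists a b, [/\ I a, I b & a < b].

(* Derivatives are taken relative to I, hence are one-sided at the end points
   of I that belong to it; values of functions outside I play no role. *)
Definition iquotient (R : realType) (U : normedModType R) (I : set R)
    (f : R -> U) (t : R) : set_system U :=
  (fun x => (x - t)^-1 *: (f x - f t)) @ within I t^'.

Definition ideriv (R : realType) (U : normedModType R) (I : set R)
    (f : R -> U) : R -> U :=
  fun t => lim (iquotient I f t).

Definition ideriv_n (R : realType) (U : normedModType R) (I : set R)
    (n : nat) (f : R -> U) : R -> U :=
  iter n (ideriv I) f.

Definition ismooth (R : realType) (U : normedModType R) (I : set R)
    (f : R -> U) : Prop :=
  forall n t, I t -> cvg (iquotient I (ideriv_n I n f) t).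

(* A null curve alpha parametrized by pseudo-arc length, with its Cartan frame
   (T, N, B1, B2) and Cartan curvatures k2, k3. *)
Record null_cartan_curve (R : realType) (I : set R)
    (alpha T N B1 B2 : R -> 'rV[R]_4) (k2 k3 : R -> R) : Prop :=
  NullCartanCurve {
    ncc_domain : curve_domain I;
    ncc_smooth : ismooth I alpha;
    ncc_regular : forall s, I s -> ideriv I alpha s <> 0;
    ncc_null : forall s, I s ->
      mink_dot (ideriv I alpha s) (ideriv I alpha s) = 0;
    ncc_pseudo_arc : forall s, I s ->
      mink_dot (ideriv_n I 2 alpha s) (ideriv_n I 2 alpha s) = 1;
    ncc_T : forall s, I s -> T s = ideriv I alpha s;
    ncc_N : forall s, I s -> N s = ideriv_n I 2 alpha s;
    ncc_smooth_B1 : ismooth I B1;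
    ncc_smooth_B2 : ismooth I B2;
    ncc_smooth_k2 : ismooth I (k2 : R -> R^o);
    ncc_smooth_k3 : ismooth I (k3 : R -> R^o);
    ncc_TT : forall s, I s -> mink_dot (T s) (T s) = 0;
    ncc_B2B2 : forall s, I s -> mink_dot (B2 s) (B2 s) = 0;
    ncc_NN : forall s, I s -> mink_dot (N s) (N s) = 1;
    ncc_B1B1 : forall s, I s -> mink_dot (B1 s) (B1 s) = 1;
    ncc_TB2 : forall s, I s -> mink_dot (T s) (B2 s) = 1;
    ncc_TN : forall s, I s -> mink_dot (T s) (N s) = 0;
    ncc_TB1 : forall s, I s -> mink_dot (T s) (B1 s) = 0;
    ncc_NB1 : forall s, I s -> mink_dot (N s) (B1 s) = 0;
    ncc_NB2 : forall s, I s -> mink_dot (N s) (B2 s) = 0;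
    ncc_B1B2 : forall s, I s -> mink_dot (B1 s) (B2 s) = 0;
    ncc_det : forall s, I s -> \det (frame_mx (T s) (N s) (B1 s) (B2 s)) = 1;
    ncc_dT : forall s, I s -> ideriv I T s = N s;
    ncc_dN : forall s, I s -> ideriv I N s = k2 s *: B1 s - B2 s;
    ncc_dB1 : forall s, I s -> ideriv I B1 s = k3 s *: T s - k2 s *: N s;
    ncc_dB2 : forall s, I s -> ideriv I B2 s = - (k3 s *: B1 s) }.

Definition unit_axis (R : realType) (I : set R) (T N B1 : R -> 'rV[R]_4)
    (k2 k3 : R -> R) (V : R -> 'rV[R]_4) : Prop :=
  (forall s, I s -> mink_dot (V s) (V s) = 1) /\
  exists l0 m0 n0 : R,
    [/\ l0 = 0, n0 <> 0 & m0 ^+ 2 + n0 ^+ 2 = 1] /\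
    [/\ forall s, I s -> V s = l0 *: T s + m0 *: N s + n0 *: B1 s,
        forall s, I s -> l0 = n0 * k2 s &
        forall s, I s ->
          k3 s * (m0 / n0) ^+ 2 + k2 s ^+ 2 * (m0 / n0) - k3 s = 0].

Definition axis_plus (R : realType) (N B1 : R -> 'rV[R]_4) (s : R) : 'rV[R]_4 :=
  (Num.sqrt 2)^-1 *: (N s + B1 s).

Definition axis_minus (R : realType) (N B1 : R -> 'rV[R]_4) (s : R) : 'rV[R]_4 :=
  (Num.sqrt 2)^-1 *: (N s - B1 s).

(* The operator p(d/ds), so that p is the characteristic polynomial of the
   constant-coefficient equation p(d/ds) y = 0. *)
Definition diff_op (R : realType) (U : normedModType R) (I : set R)
    (p : {poly R}) (y : R -> U) : R -> U :=
  fun s => \sum_(i < size p) p`_i *: ideriv_n I i y s.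

Definition ode_eigenvalue (R : realType) (p : {poly R}) (z : R[i]) : Prop :=
  root (map_poly (real_complex R) p) z.

(* Main.v *)
Require Import Defs.
From HB Require Import structures.
From mathcomp Require Import all_boot all_order all_algebra.
From mathcomp Require Import all_classical all_reals all_analysis.
From mathcomp Require Import complex.
From mathcomp Require Import ring lra.

Set Implicit Arguments.
Unset Strict Implicit.
Unset Printing Implicit Defensive.

Import Order.TTheory GRing.Theory Num.Theory.
Import numFieldNormedType.Exports.

Local Open Scope classical_set_scope.
Local Open Scope ring_scope.

(** Parts (a)-(c) are pointwise algebra.  Since [n0 <> 0], the condition
    [0 = n0 * k2] gives [k2 = 0]; the second constraint then reads
    [k3 * (r ^+ 2 - 1) = 0], so a single point with [k3 <> 0] forces the
    constant [r = m0 / n0] to be [1] or [-1], and normalization gives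
    [m0 ^+ 2 = n0 ^+ 2 = 1/2] ([constraint_ratio], [sqr_coef_half]).  Up to the
    common sign of the axis, which is the sign of the coefficient of [N], the
    two choices of [r] are the two axes of [unit_axisP].  The products of
    frame fields reduce every Minkowski product to one in the coefficients
    ([mink_dot_frame]); in it the coefficient of [B2] only meets that of [T],
    because [B2] is orthogonal to [N] and [B1], so it drops out with [l0 = 0].

    For (d), when [k2 = 0] and [k3 = k] the Cartan equations close up into a
    chain [T, N, - B2, k B1, k^2 T] in which each term is the derivative of
    the preceding one ([tangent_deriv4]).  As the equations hold on [I] only,
    this rests on two facts about derivatives relative to an interval: they
    depend only on the values of the function on the interval ([eq_ideriv]),
    and they commute with scalars ([iderivZ]), which uses the uniqueness of
    limits, hence that every point of a nondegenerate interval is an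
    accumulation point of it ([within_dnbhs_proper]).  Finally, with
    [q = sqrt |k|], [z^4 - k^2 = z^4 - q^4] splits into the four linear
    factors [z - q], [z + q], [z - iq], [z + iq] ([ode_eigenvalueP]). *)

(** * The Minkowski product on frame combinations *)

Section MinkowskiProduct.
Variable R : realType.
Implicit Types (x y z : 'rV[R]_4) (a : R).

Lemma mink_dotC x y : mink_dot x y = mink_dot y x.
Proof. by rewrite /mink_dot; ring. Qed.

Lemma mink_dotDl x y z : mink_dot (x + y) z = mink_dot x z + mink_dot y z.
Proof. by rewrite /mink_dot !mxE; ring. Qed.

Lemma mink_dotZl a x y : mink_dot (a *: x) y = a * mink_dot x y.
Proof. by rewrite /mink_dot !mxE; ring. Qed.

Lemma mink_dotDr x y z : mink_dot x (y + z) = mink_dot x y + mink_dot x z.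
Proof. by rewrite mink_dotC mink_dotDl !(mink_dotC x). Qed.

Lemma mink_dotZr a x y : mink_dot x (a *: y) = a * mink_dot x y.
Proof. by rewrite mink_dotC mink_dotZl mink_dotC. Qed.

End MinkowskiProduct.

Section FrameProducts.
Variables (R : realType) (I : set R).
Variables (alpha T N B1 B2 : R -> 'rV[R]_4) (k2 k3 : R -> R).
Hypothesis Halpha : null_cartan_curve I alpha T N B1 B2 k2 k3.

(** The term [l * d] is the null coupling: [T] is null and orthogonal to [N]
    and [B1], so its coefficient meets only that of [B2]. *)
Lemma mink_dot_frame (l m n a b c d s : R) : I s ->
  mink_dot (l *: T s + m *: N s + n *: B1 s)
           (a *: T s + b *: N s + c *: B1 s + d *: B2 s) =
  l * d + m * b + n * c.
Proof.
move=> Is; rewrite !(mink_dotDl, mink_dotDr, mink_dotZl, mink_dotZr).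
rewrite (mink_dotC (N s) (T s)) (mink_dotC (B1 s) (T s)).
rewrite (mink_dotC (B1 s) (N s)).
rewrite (ncc_TT Halpha Is) (ncc_TN Halpha Is) (ncc_TB1 Halpha Is).
rewrite (ncc_TB2 Halpha Is) (ncc_NN Halpha Is) (ncc_NB1 Halpha Is).
rewrite (ncc_NB2 Halpha Is) (ncc_B1B1 Halpha Is) (ncc_B1B2 Halpha Is).
ring.
Qed.

Lemma mink_dot_spacelike (m n b c s : R) : I s ->
  mink_dot (m *: N s + n *: B1 s) (b *: N s + c *: B1 s) = m * b + n * c.
Proof.
move=> Is; have := mink_dot_frame 0 m n 0 b c 0 Is.
by rewrite !scale0r !add0r addr0 mulr0 add0r.
Qed.

Lemma axis_plusE s : axis_plus N B1 s =
  (Num.sqrt 2)^-1 *: N s + (Num.sqrt 2)^-1 *: B1 s.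
Proof. exact: scalerDr. Qed.

Lemma axis_minusE s : axis_minus N B1 s =
  (Num.sqrt 2)^-1 *: N s + (- (Num.sqrt 2)^-1) *: B1 s.
Proof. by rewrite /axis_minus scalerBr scaleNr. Qed.

Lemma mink_dot_axes s : I s ->
  mink_dot (axis_plus N B1 s) (axis_minus N B1 s) = 0.
Proof.
by move=> Is; rewrite axis_plusE axis_minusE mink_dot_spacelike // mulrN subrr.
Qed.

End FrameProducts.

(** * Unit axes *)

Section Coefficients.
Variable R : realType.
Implicit Types k r m n e : R.

Lemma ratio_eq1 m n : n <> 0 -> m / n = 1 <-> m = n.
Proof.
move=> /eqP n0; split=> [/(congr1 ( *%R^~ n))|->]; last by rewrite divff.
by rewrite divfK // mul1r.
Qed.

Lemma ratio_eqN1 m n : n <> 0 -> m / n = -1 <-> m = - n.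
Proof.
move=> /eqP n0; split=> [/(congr1 ( *%R^~ n))|->]; last by rewrite mulNr divff.
by rewrite divfK // mulN1r.
Qed.

Lemma constraint_ratio k r :
  k <> 0 -> k * (r ^+ 2 - 1) = 0 -> r = 1 \/ r = -1.
Proof.
move=> /eqP k0 /eqP; rewrite mulf_eq0 (negPf k0) /= subr_eq0 sqrf_eq1.
by case/orP => /eqP; [left | right].
Qed.

Lemma sqr_invsqrt2 : (Num.sqrt 2)^-1 ^+ 2 = 2^-1 :> R.
Proof. by rewrite exprVn sqr_sqrtr. Qed.

(** The sign [e] is recorded as a factor because it becomes the sign of the
    whole axis. *)
Lemma half_square_root m : m ^+ 2 = 2^-1 ->
  exists2 e, e = 1 \/ e = -1 & m = e * (Num.sqrt 2)^-1.
Proof.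
rewrite -sqr_invsqrt2 => /eqP; rewrite eqf_sqr => /orP[] /eqP ->.
  by exists 1; [left | rewrite mul1r].
by exists (-1); [right | rewrite mulN1r].
Qed.

Lemma sqr_coef_half m n : m ^+ 2 + n ^+ 2 = 1 -> m = n \/ m = - n ->
  m ^+ 2 = 2^-1.
Proof.
move=> mn1 mn; have nm : n ^+ 2 = m ^+ 2 by case: mn => ->; rewrite ?sqrrN.
by move: mn1; rewrite nm; lra.
Qed.

End Coefficients.

Section UnitAxes.
Variables (R : realType) (I : set R).
Variables (alpha T N B1 B2 : R -> 'rV[R]_4) (k2 k3 : R -> R).
Hypothesis Halpha : null_cartan_curve I alpha T N B1 B2 k2 k3.
Hypothesis k2_0 : forall s, I s -> k2 s = 0.

(** Squares equal to one half give the normalization and [(m / n) ^+ 2 = 1],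
    which is the second constraint when [k2 = 0]; the first one is [k2 = 0]
    itself. *)
Lemma isotropic_unit_axis (m n : R) (A : R -> 'rV[R]_4) :
  m ^+ 2 = 2^-1 -> m = n \/ m = - n ->
  (forall s, I s -> A s = m *: N s + n *: B1 s) ->
  unit_axis I T N B1 k2 k3 A.
Proof.
move=> m2 mn AE.
have n2 : n ^+ 2 = 2^-1 by rewrite -m2; case: mn => ->; rewrite ?sqrrN.
have mn1 : m ^+ 2 + n ^+ 2 = 1 by rewrite m2 n2; lra.
have n0 : n <> 0 by move=> n0; move: n2; rewrite n0; lra.
split=> [s Is|].
  by rewrite AE // (mink_dot_spacelike Halpha) // -!expr2.
exists 0, m, n; split; first by split.
split=> s Is; [by rewrite AE // scale0r add0r | by rewrite k2_0 // mulr0 |].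
have -> : (m / n) ^+ 2 = 1.
  by rewrite expr_div_n m2 n2 divff // invr_eq0 pnatr_eq0.
by rewrite k2_0 //; ring.
Qed.

(** The coefficients of an axis are constants, so the constraint at one point
    where [k3] does not vanish already fixes their ratio on all of [I]. *)
Lemma unit_axisP (A : R -> 'rV[R]_4) :
  (exists2 s, I s & k3 s <> 0) ->
  unit_axis I T N B1 k2 k3 A <->
  exists2 e : R, e = 1 \/ e = -1 &
    (forall s, I s -> A s = e *: axis_plus N B1 s) \/
    (forall s, I s -> A s = e *: axis_minus N B1 s).
Proof.
move=> [s0 Is0 k30]; split.
  move=> [_ [l [m [n [[l0 n0 mn1] [AE _ Hr]]]]]].
  have mn : m = n \/ m = - n.
    have : k3 s0 * ((m / n) ^+ 2 - 1) = 0.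
      by rewrite -(Hr _ Is0) k2_0 //; ring.
    case/(constraint_ratio k30) => [/(ratio_eq1 _ n0)|/(ratio_eqN1 _ n0)].
      by left.
    by right.
  (* [m] and [n] may have opposite signs; [e] is the sign of [m], the
     coefficient of [N], which is positive in both standard axes *)
  have [e e1 me] := half_square_root (sqr_coef_half mn1 mn).
  exists e => //; case: mn => mn; [left | right] => s Is.
    by rewrite AE // l0 scale0r add0r axis_plusE scalerDr !scalerA -me mn.
  rewrite AE // l0 scale0r add0r axis_minusE scalerDr !scalerA mulrN -me.
  by rewrite mn opprK.
move=> [e e1 H].
have e2 : (e * (Num.sqrt 2)^-1) ^+ 2 = 2^-1.
  by rewrite exprMn sqr_invsqrt2; case: e1 => ->; rewrite ?sqrrN expr1n mul1r.
case: H => AE.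
  apply: (isotropic_unit_axis e2 (or_introl erefl)) => s Is.
  by rewrite AE // axis_plusE scalerDr !scalerA.
apply: (isotropic_unit_axis (n := - (e * (Num.sqrt 2)^-1)) e2).
  by right; rewrite opprK.
by move=> s Is; rewrite AE // axis_minusE scalerDr !scalerA mulrN.
Qed.

End UnitAxes.

(** * Derivatives relative to an interval *)

Section RelativeDerivative.
Variables (R : realType) (U : normedModType R) (I : set R).
Implicit Types (f g : R -> U) (t : R).

(** Limits of difference quotients relative to [I] are unique, even at an end
    point of [I]: [I] contains a second point [c], hence the segment from [t]
    to [c], and so points other than [t] at any small distance from [t]. *)
Lemma within_dnbhs_proper t :
  curve_domain I -> I t -> ProperFilter (within I t^').
Proof.
move=> [itvI [a [b [Ia Ib ab]]]] It.
apply: Build_ProperFilter_ex => P /nbhs_ballP [e /= e0 He].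
have [c Ic ct] : exists2 c, I c & c != t.
  by have [->|ta] := eqVneq t a; [
     exists b; rewrite ?gt_eqF | exists a; rewrite // eq_sym].
have [tc|tc|tc] := ltgtP t c; last by rewrite tc eqxx in ct.
- pose x := Num.min c (t + e / 2).
  have tx : t < x by rewrite lt_min tc ltrDl divr_gt0.
  have xe : x <= t + e / 2 by rewrite ge_min lexx orbT.
  exists x; apply: He.
  + by rewrite /ball /= ltr0_norm ?subr_lt0 //; lra.
  + by rewrite gt_eqF.
  + by apply: (itvI _ _ It Ic); rewrite (ltW tx) ge_min lexx.
- pose x := Num.max c (t - e / 2).
  have tx : x < t by rewrite gt_max tc gtrBl divr_gt0.
  have xe : t - e / 2 <= x by rewrite le_max lexx orbT.
  exists x; apply: He.
  + by rewrite /ball /= gtr0_norm ?subr_gt0 //; lra.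
  + by rewrite lt_eqF.
  + by apply: (itvI _ _ Ic It); rewrite (ltW tx) le_max lexx.
Qed.

(** The difference quotients at a point of [I] run through points of [I] only;
    hence a formula for a derivative known on [I] can be differentiated
    again. *)
Lemma eq_ideriv f g t :
  I t -> (forall s, I s -> f s = g s) -> ideriv I f t = ideriv I g t.
Proof.
move=> It fg; rewrite /ideriv /iquotient; congr lim.
have near_fg : {near within I t^', (fun x => (x - t)^-1 *: (f x - f t)) =1
                                   (fun x => (x - t)^-1 *: (g x - g t))}.
  by rewrite near_withinE; apply: nearW => x Ix; rewrite !fg.
apply/seteqP; split; apply: near_eq_cvg => //.
by apply: filterS near_fg => x ->.
Qed.

Lemma ismooth_derivable f t :
  ismooth I f -> I t -> cvg (iquotient I f t).
Proof. by move=> sf; exact: (sf 0%N). Qed.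

(** Convergence is assumed because [ideriv] takes an arbitrary value where the
    quotients diverge. *)
Lemma iderivZ (a : R) f t : curve_domain I -> I t ->
  cvg (iquotient I f t) ->
  ideriv I (fun s => a *: f s) t = a *: ideriv I f t.
Proof.
move=> domI It cf; have PF := within_dnbhs_proper domI It.
apply: cvg_lim; first exact: norm_hausdorff.
rewrite /iquotient.
have -> : (fun x => (x - t)^-1 *: (a *: f x - a *: f t)) =
          (fun x => a *: ((x - t)^-1 *: (f x - f t))).
  by apply/funext => x; rewrite -scalerBr !scalerA mulrC.
exact: cvgZl_tmp.
Qed.

End RelativeDerivative.

(** * The tangent equation *)

Section TangentEquation.
Variables (R : realType) (I : set R).
Variables (alpha T N B1 B2 : R -> 'rV[R]_4) (k2 k3 : R -> R).
Hypothesis Halpha : null_cartan_curve I alpha T N B1 B2 k2 k3.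

(** With [k2 = 0], differentiation takes [T] to [N] and then to [- B2]; the
    equations for [B2] and [B1] then each contribute a factor [k] and lead back
    to [T]. *)
Lemma tangent_deriv4 (k : R) :
  (forall s, I s -> k2 s = 0) -> (forall s, I s -> k3 s = k) ->
  forall s, I s -> ideriv_n I 4 T s = k ^+ 2 *: T s.
Proof.
move=> k2_0 k3_k s Is; have domI := ncc_domain Halpha.
have T1 t : I t -> ideriv_n I 1 T t = N t by exact: (ncc_dT Halpha).
have T2 t : I t -> ideriv_n I 2 T t = -1 *: B2 t.
  move=> It; rewrite [LHS](eq_ideriv It T1) (ncc_dN Halpha It) k2_0 //.
  by rewrite scale0r add0r scaleN1r.
have T3 t : I t -> ideriv_n I 3 T t = k *: B1 t.
  move=> It; rewrite [LHS](eq_ideriv It T2) iderivZ //.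
    by rewrite (ncc_dB2 Halpha It) k3_k // scaleN1r opprK.
  exact: ismooth_derivable (ncc_smooth_B2 Halpha) It.
rewrite [LHS](eq_ideriv Is T3) iderivZ //; last first.
  exact: ismooth_derivable (ncc_smooth_B1 Halpha) Is.
by rewrite (ncc_dB1 Halpha Is) k3_k // k2_0 // scale0r subr0 scalerA expr2.
Qed.

End TangentEquation.

(** The sum over coefficients keeps only the extreme terms; the exponent is a
    successor so that these two are distinct. *)
Lemma diff_op_XnsubC (R : realType) (U : normedModType R) (I : set R)
    (n : nat) (a : R) (y : R -> U) (s : R) :
  diff_op I ('X^(n.+1) - a%:P) y s = ideriv_n I n.+1 y s - a *: y s.
Proof.
rewrite /diff_op size_XnsubC // big_ord_recr big_ord_recl /=.
rewrite big1 => [|i _]; rewrite !coefB !coefXn !coefC /=.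
  by rewrite eqxx sub0r subr0 scale1r scaleNr addr0 addrC.
by rewrite /bump /= add1n eqSS ltn_eqF // subr0 scale0r.
Qed.

(** For either sign of [k], [k ^+ 2] is the fourth power of [sqrt |k|], so the
    four roots form one list for both signs. *)
Lemma ode_eigenvalueP (R : realType) (k : R) (z : R[i]) :
  ode_eigenvalue ('X^4 - (k ^+ 2)%:P) z <->
  z \in [:: (Num.sqrt `|k|)%:C; - (Num.sqrt `|k|)%:C;
            'i * (Num.sqrt `|k|)%:C; - ('i * (Num.sqrt `|k|)%:C)]%C.
Proof.
set q := (Num.sqrt `|k|)%:C%C.
have q4 : (k ^+ 2)%:C%C = q ^+ 4.
  by rewrite -rmorphXn /= (exprM _ 2 2) sqr_sqrtr // real_normK ?num_real.
have factor : z ^+ 4 - q ^+ 4 =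
    (z - q) * (z + q) * ((z - 'i%C * q) * (z + 'i%C * q)).
  have -> : (z - 'i%C * q) * (z + 'i%C * q) = z ^+ 2 - 'i%C ^+ 2 * q ^+ 2.
    by ring.
  by rewrite sqr_i; ring.
rewrite /ode_eigenvalue rmorphB /= map_polyXn map_polyC /= rootE !hornerE.
by rewrite q4 factor !mulf_eq0 !subr_eq0 !addr_eq0 !inE -!orbA.
Qed.

(** * The four assertions *)

Theorem proposition6 (R : realType) (I : set R)
    (alpha T N B1 B2 : R -> 'rV[R]_4) (k2 k3 : R -> R)
    (Halpha : null_cartan_curve I alpha T N B1 B2 k2 k3)
    (l0 m0 n0 : R) (V : R -> 'rV[R]_4)
    (HV : forall s, I s -> V s = l0 *: T s + m0 *: N s + n0 *: B1 s)
    (Hl0 : l0 = 0) (Hn0 : n0 <> 0) (Hunit : m0 ^+ 2 + n0 ^+ 2 = 1) :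
  (forall s, I s -> V s = m0 *: N s + n0 *: B1 s) /\
  (* (a) *)
  ((forall s, I s -> l0 = n0 * k2 s) -> forall s, I s -> k2 s = 0) /\
  (* (b) *)
  ((forall s, I s -> k2 s = 0) ->
    (forall s, I s ->
      (k3 s * (m0 / n0) ^+ 2 + k2 s ^+ 2 * (m0 / n0) - k3 s = 0 <->
       k3 s * ((m0 / n0) ^+ 2 - 1) = 0)) /\
    ((exists2 s, I s & k3 s <> 0) ->
      [/\ (forall s, I s ->
             k3 s * (m0 / n0) ^+ 2 + k2 s ^+ 2 * (m0 / n0) - k3 s = 0) ->
            m0 / n0 = 1 \/ m0 / n0 = -1,
          (m0 / n0 = 1 \/ m0 / n0 = -1) <->
            [/\ m0 = n0 \/ m0 = - n0,
                m0 = 1 / Num.sqrt 2 \/ m0 = - (1 / Num.sqrt 2) &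
                n0 = 1 / Num.sqrt 2 \/ n0 = - (1 / Num.sqrt 2)],
          forall A : R -> 'rV[R]_4,
            unit_axis I T N B1 k2 k3 A <->
            exists2 e : R, e = 1 \/ e = -1 &
              (forall s, I s -> A s = e *: axis_plus N B1 s) \/
              (forall s, I s -> A s = e *: axis_minus N B1 s) &
          forall s, I s ->
            mink_dot (axis_plus N B1 s) (axis_minus N B1 s) = 0])) /\
  (* (c) *)
  (forall (a b c d : R -> R) (W : R -> 'rV[R]_4),
    (forall s, I s ->
       W s = a s *: T s + b s *: N s + c s *: B1 s + d s *: B2 s) ->
    forall s, I s ->
      [/\ mink_dot (V s) (W s) = l0 * d s + m0 * b s + n0 * c s,
          l0 * d s = 0 &
          forall c0 : R,
            mink_dot (V s) (W s) = c0 <-> m0 * b s + n0 * c s = c0]) /\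
  (* (d) *)
  (forall k : R, k <> 0 ->
    (forall s, I s -> k2 s = 0) -> (forall s, I s -> k3 s = k) ->
    [/\ forall s, I s -> ideriv_n I 4 T s - k ^+ 2 *: T s = 0,
        forall (y : R -> 'rV[R]_4) (s : R),
          diff_op I ('X^4 - (k ^+ 2)%:P) y s = ideriv_n I 4 y s - k ^+ 2 *: y s &
        forall z : R[i],
          ode_eigenvalue ('X^4 - (k ^+ 2)%:P) z <->
          z \in [:: (Num.sqrt `|k|)%:C; - (Num.sqrt `|k|)%:C;
                    'i * (Num.sqrt `|k|)%:C; - ('i * (Num.sqrt `|k|)%:C)]%C]).
Proof.
have VE s : I s -> V s = m0 *: N s + n0 *: B1 s.
  by move=> Is; rewrite HV // Hl0 scale0r add0r.
have Hratio : (m0 / n0 = 1 \/ m0 / n0 = -1) <-> (m0 = n0 \/ m0 = - n0).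
  by rewrite ratio_eq1 // ratio_eqN1.
split=> //; split.
  move=> Hl s Is; move: (Hl s Is); rewrite Hl0 => /esym/eqP.
  by rewrite mulf_eq0 => /orP[/eqP/Hn0|/eqP].
split.
  move=> k2_0; split=> [s Is|[s0 Is0 k30]].
    rewrite k2_0 //.
    suff -> : k3 s * (m0 / n0) ^+ 2 + 0 ^+ 2 * (m0 / n0) - k3 s =
              k3 s * ((m0 / n0) ^+ 2 - 1) by [].
    by ring.
  split.
  - move=> /(_ s0 Is0) Hr; apply: (constraint_ratio k30).
    by rewrite -Hr k2_0 //; ring.
  - split=> [/Hratio mn|[mn _ _]]; last exact/Hratio.
    have [e e1 me] := half_square_root (sqr_coef_half Hunit mn).
    have m2 : m0 = 1 / Num.sqrt 2 \/ m0 = - (1 / Num.sqrt 2).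
      by rewrite me div1r; case: e1 => ->; rewrite ?mul1r ?mulN1r; [left|right].
    split=> //; case: mn m2 => -> //; case=> /(congr1 -%R); rewrite !opprK => ->.
      by right.
    by left.
  - by move=> A; apply: (unit_axisP Halpha k2_0); exists s0.
  - exact: mink_dot_axes Halpha.
split.
  move=> a b c d W WE s Is.
  have VW : mink_dot (V s) (W s) = l0 * d s + m0 * b s + n0 * c s.
    by rewrite HV // WE // (mink_dot_frame Halpha).
  by split=> // [|c0]; rewrite ?VW Hl0 mul0r ?add0r.
move=> k k0 k2_0 k3_k; split=> [s Is|y s|z].
- by rewrite (tangent_deriv4 Halpha k2_0 k3_k) // subrr.
- exact: diff_op_XnsubC.
- exact: ode_eigenvalueP.
Qed.
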